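(* Let $d\ge 2$ and let $p:[n]\to\mathbb R^d$ be such that $\|p(i)\|=1$ for all $i\in[n]$ and $\sum_{i=1}^n p(i)=0$. Assume that the image of $p$ contains at least three distinct points. Then the second largest eigenvalue of the stiffness matrix $L(K_n,p)$ is $n/2$.
   Context: Here $[n]=\{1,\dots,n\}$ is the vertex set of the complete graph $K_n$, and $\|\cdot\|$ is the Euclidean norm. For $p:[n]\to\mathbb R^d$ and $1\le i<j\le n$ let \[ d_{ij}=\frac{p(i)-p(j)}{\|p(i)-p(j)\|}\ \text{ if } p(i)\ne p(j),\qquad d_{ij}=0\ \text{ if } p(i)=p(j). \] Let $1_1,\dots,1_n$ be the standard basis of $\mathbb R^n$ and let $\mathbf v_{ij}=(1_i-1_j)\otimes d_{ij}\in\mathbb R^{dn}$ (Kronecker product). The normalized rigidity matrix $R(K_n,p)$ is the $dn\times\binom n2$ matrix whose columns are the vectors $\mathbf v_{ij}$, $1\le i<j\le n$. The stiffness matrix is $L(K_n,p)=R(K_n,p)R(K_n,p)^T$, a real symmetric positive semidefinite $dn\times dn$ matrix. Eigenvalues are listed in nonincreasing order, counted with multiplicity. *)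

(* Defs.v *)
From HB Require Import structures.
From mathcomp Require Import all_boot all_order all_algebra.
From mathcomp Require Import mxtens.
From mathcomp Require Import reals.

Set Implicit Arguments.
Unset Strict Implicit.
Unset Printing Implicit Defensive.

Import Order.TTheory GRing.Theory Num.Theory.
Local Open Scope ring_scope.

Definition enorm (R : realType) (d : nat) (x : 'cV[R]_d) : R :=
  Num.sqrt (\sum_k x k 0 ^+ 2).

Definition direction (R : realType) (n d : nat) (p : 'I_n -> 'cV[R]_d)
    (i j : 'I_n) : 'cV[R]_d :=
  if p i == p j then 0 else (enorm (p i - p j))^-1 *: (p i - p j).

(* [tensmx] is the Kronecker product; its number of columns, [1 * 1], is
   convertible to [1]. *)
Definition edge_vector (R : realType) (n d : nat) (p : 'I_n -> 'cV[R]_d)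
    (i j : 'I_n) : 'cV[R]_(n * d) :=
  tensmx (delta_mx i 0 - delta_mx j 0 : 'cV[R]_n) (direction p i j).

Definition edges (n : nat) : {set 'I_n * 'I_n} :=
  [set ij : 'I_n * 'I_n | (ij.1 < ij.2)%N].

Lemma card_edges (n : nat) : #|edges n| = 'C(n, 2).
Proof.
rewrite cardsE -sum1_card -bin2_sum big_mkord.
rewrite -(pair_big_dep xpredT (fun i j : 'I_n => i < j)%N (fun=> fun=> 1%N)) /=.
rewrite (exchange_big_dep xpredT) //=; apply: eq_bigr => j _.
by rewrite -(big_ord_widen _ (fun=> 1%N) (ltnW (ltn_ord j))) sum1_card card_ord.
Qed.

Definition rigidity_mx (R : realType) (n d : nat) (p : 'I_n -> 'cV[R]_d) :
    'M[R]_(n * d, #|edges n|) :=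
  \matrix_(r, e)
    edge_vector p (enum_val e).1 (enum_val e).2 r 0.

Definition stiffness_mx (R : realType) (n d : nat) (p : 'I_n -> 'cV[R]_d) :
    'M[R]_(n * d) :=
  rigidity_mx p *m (rigidity_mx p)^T.

(* [s] lists all eigenvalues of [A] with algebraic multiplicity, largest first;
   no such [s] exists unless the characteristic polynomial splits over [R]. *)
Definition eigenvalue_list (R : realType) (m : nat) (A : 'M[R]_m) (s : seq R) :
    Prop :=
  sorted >=%R s /\ char_poly A = \prod_(x <- s) ('X - x%:P).

Lemma eigenvalue_list_uniq (R : realType) (m : nat) (A : 'M[R]_m)
    (s t : seq R) :
  eigenvalue_list A s -> eigenvalue_list A t -> s = t.
Proof.
move=> [sort_s As] [sort_t At]; apply: (sorted_eq (leT := >=%R)) => //.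
- exact: ge_trans.
- exact: ge_anti.
- by apply: prod_XsubC_eq; rewrite -As -At.
Qed.

(* Positions count from 1 and multiplicities are included. *)
Definition is_kth_largest_eigenvalue (R : realType) (m : nat) (A : 'M[R]_m)
    (k : nat) (a : R) : Prop :=
  exists2 s : seq R, eigenvalue_list A s & (0 < k <= size s)%N /\ s`_k.-1 = a.

(* Main.v *)
Require Import Defs.
From mathcomp Require Import all_boot all_order all_algebra.
From mathcomp Require Import spectral sesquilinear complex mxtens.
From mathcomp Require Import reals ring lra.
Import Order.TTheory GRing.Theory Num.Theory.
Set Implicit Arguments.
Unset Strict Implicit.
Unset Printing Implicit Defensive.
Local Open Scope ring_scope.

(* Radial vectors [x_i = f_i p_i + m] are mapped by the stiffness matrix [L] to
   explicit vectors: [p] itself is an eigenvector for [n], and [f p] minus its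
   mean is one for [n / 2] whenever [\sum_i f_i = 0].  Since [L] is symmetric, it
   remains to show [<x, L x> <= (n / 2) |x|^2] for [x] orthogonal to [p].  With
   [z = x_i - x_j] and [c = <p_i, p_j>], the Gram determinant of [p_i], [p_j], [z]
   gives
     [<d_ij, z>^2 <= (1 + c) |z|^2 / 2 - <p_i, z> <p_j, z>],
   and summing the right-hand side over all [i], [j] yields
     [n |x|^2 + <p, x>^2 - |\sum_i x_i|^2 - |\sum_i p_i /\ x_i|^2]
   (with [<u /\ v, u' /\ v'> = <u, u'> <v, v'> - <u, v'> <v, u'>]). *)

(** * Eigenvalues of real symmetric matrices *)

Lemma char_poly_conj (F : fieldType) (m : nat) (P B : 'M[F]_m) :
  P \in unitmx -> char_poly (invmx P *m B *m P) = char_poly B.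
Proof.
move=> Pu; rewrite /char_poly.
have -> : char_poly_mx (invmx P *m B *m P) =
   map_mx polyC (invmx P) *m char_poly_mx B *m map_mx polyC P.
  rewrite /char_poly_mx mulmxBr mulmxBl -!map_mxM /=; congr (_ - _).
  by rewrite mul_mx_scalar -scalemxAl -map_mxM /= mulVmx // map_mx1 scalemx1.
rewrite !det_mulmx mulrAC -det_mulmx -map_mxM /= mulVmx // map_mx1 det1.
by rewrite mul1r.
Qed.

(** Over the complex extension of [R] the matrix is Hermitian, hence unitarily diagonalizable with
    real diagonal. So its characteristic polynomial already splits over [R], and the rows of the
    unitary matrix supply enough independent eigenvectors. *)
Lemma symmetric_eigenvalues (R : rcfType) (m : nat) (A : 'M[R]_m) :
  A^T = A ->
  exists2 s : seq R, char_poly A = \prod_(x <- s) ('X - x%:P) &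
    forall a, (count_mem a s <= \rank (eigenspace A a))%N.
Proof.
move=> symA.
pose f := real_complex R; pose C := map_mx f A.
have hermC : C \is hermsymmx.
  apply: realsym_hermsym.
    by rewrite qualifE /= expr0 scale1r map_mx_id // /C map_trmx symA.
  by apply/mxOverP => i j; rewrite mxE; apply/complex_realP; eexists.
have realD := hermitian_spectral_diag_real hermC.
have /hermitian_normalmx/orthomx_spectralP := hermC.
set U := spectralmx C; set D := spectral_diag C => CE.
have Uu : U \in unitmx by apply: spectral_unit.
pose d k := complex.Re (D 0 k).
have dE k : D 0 k = f (d k).
  by rewrite /f /d RRe_real //; move/mxOverP: realD; apply.
exists [seq d k | k <- enum 'I_m].
  apply: (map_poly_inj f); rewrite map_char_poly -/C CE char_poly_conj //.
  rewrite char_poly_trig ?diag_mx_is_trig // big_map big_enum rmorph_prod /=.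
  apply: eq_bigr => k _; rewrite !mxE eqxx mulr1n dE.
  by rewrite rmorphB /= map_polyX map_polyC.
move=> a; pose S := [set k | d k == a].
have -> : count_mem a [seq d k | k <- enum 'I_m] = #|S|.
  rewrite -sum1_count big_map big_enum_cond -sum1_card /=.
  by apply: eq_bigl => k; rewrite !inE.
(* Extension of scalars preserves rank, so it suffices to find [#|S|] orthonormal rows in the
   complex eigenspace. *)
rewrite -(mxrank_map f) map_eigenspace -/C.
pose V : 'M_(#|S|, m) := rowsub enum_val U.
have VU : V \is unitarymx.
  apply/row_unitarymxP => i j; rewrite !row_rowsub.
  have /row_unitarymxP -> := spectral_unitarymx C.
  by rewrite (inj_eq enum_val_inj).
rewrite -{1}(mxrank_unitary VU); apply/mxrankS/row_subP => i.
rewrite row_rowsub; apply/eigenspaceP.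
have UC : U *m C = diag_mx D *m U by rewrite CE !mulmxA mulmxV // mul1mx.
have /eqP Da : d (enum_val i) == a by have := enum_valP i; rewrite inE.
by rewrite -row_mul UC mul_diag_mx; apply/rowP => j; rewrite !mxE dE Da.
Qed.

Lemma trmx_mul_gt0 (R : realDomainType) (m : nat) (x : 'cV[R]_m) :
  x != 0 -> 0 < (x^T *m x) 0 0.
Proof.
move=> x0; have [i xi] : exists i, x i 0 != 0.
  by apply/cV0Pn.
rewrite mxE (bigD1 i) //= ltr_pwDl ?sumr_ge0 // => [|k _]; rewrite mxE -expr2.
  by rewrite exprn_even_gt0.
by rewrite sqr_ge0.
Qed.

(** By the Rayleigh bound, eigenvectors orthogonal to [v] have eigenvalue at most [b]. Hence [a] is
    simple, all other eigenvalues are at most [b], and [w] shows that [b] occurs. *)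
Lemma second_largest_eigenvalue (R : realType) (m : nat) (A : 'M[R]_m)
    (v w : 'cV[R]_m) (a b : R) :
  A^T = A -> b < a ->
  v != 0 -> A *m v = a *: v -> w != 0 -> A *m w = b *: w ->
  (forall x : 'cV[R]_m, v^T *m x = 0 ->
     (x^T *m A *m x) 0 0 <= b * (x^T *m x) 0 0) ->
  is_kth_largest_eigenvalue A 2 b.
Proof.
move=> symA ba v0 Av w0 Aw Ab.
have vA : v^T *m A = a *: v^T by rewrite -{1}symA -trmx_mul Av linearZ.
have orth (x : 'cV[R]_m) c : A *m x = c *: x -> x != 0 -> v^T *m x = 0 -> c <= b.
  move=> Ax x0 /Ab; rewrite -mulmxA Ax -scalemxAr mxE ler_pM2r //.
  exact: trmx_mul_gt0.
have [s chA rkA] := symmetric_eigenvalues symA.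
have s_eig c : (c \in s) = eigenvalue A c.
  by rewrite eigenvalue_root_char chA root_prod_XsubC.
have eig (x : 'cV[R]_m) c : A *m x = c *: x -> x != 0 -> c \in s.
  move=> Ax x0; rewrite s_eig; apply/eigenvalueP; exists x^T.
    by rewrite -[in LHS]symA -trmx_mul Ax linearZ.
  by rewrite trmx_eq0.
(* By symmetry, an eigenvector for [c != a] is orthogonal to [v]. *)
have s_le c : c \in s -> c != a -> c <= b.
  rewrite s_eig => /eigenvalueP[x xA x0] ca.
  apply: (orth x^T); last 1 first.
  - have : v^T *m A *m x^T = v^T *m (A *m x^T) by rewrite mulmxA.
    rewrite vA -[in RHS]symA -trmx_mul xA linearZ /= -scalemxAl -scalemxAr.
    move/eqP; rewrite -subr_eq0 -scalerBl scaler_eq0 subr_eq0 eq_sym.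
    by rewrite (negPf ca) => /eqP.
  - by rewrite -[in LHS]symA -trmx_mul xA linearZ.
  - by rewrite trmx_eq0.
(* An eigenvector for [a] off the line of [v], minus its component along [v], would be an
   eigenvector for [a] orthogonal to [v], forcing [a <= b]. *)
have a1 : (count_mem a s <= 1)%N.
  apply: leq_trans (rkA a) _; apply: leq_trans (rank_leq_row v^T).
  apply/mxrankS/row_subP => i.
  set x := row i _; have /eigenspaceP xA : (x <= eigenspace A a)%MS.
    exact: row_sub.
  pose c := (x *m v) 0 0 / (v^T *m v) 0 0; pose y := x^T - c *: v.
  have vy : v^T *m y = 0.
    rewrite mulmxBr -scalemxAr -trmx_mul [x *m v]mx11_scalar.
    rewrite [v^T *m v]mx11_scalar tr_scalar_mx scale_scalar_mx divfK ?subrr //.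
    by rewrite gt_eqF ?trmx_mul_gt0.
  case: (eqVneq y 0) => [y0|y0].
    have -> : x = c *: v^T.
      by apply: trmx_inj; apply/eqP; rewrite linearZ /= trmxK -subr_eq0 -/y y0.
    exact: scalemx_sub.
  suff : a <= b by rewrite leNgt ba.
  apply: orth vy => //.
  rewrite mulmxBr -scalemxAr Av -{1}symA -trmx_mul xA linearZ /=.
  by rewrite scalerA mulrC -scalerA -scalerBr.
pose t := sort >=%R s.
have st : perm_eq t s by rewrite perm_sort.
have sorted_t : sorted >=%R t by apply: sort_sorted => x y; apply: le_total.
exists t; first by split => //; rewrite chA; apply: perm_big; rewrite perm_sym.
have a_t : a \in t by rewrite (perm_mem st) (eig v).
have b_t : b \in t by rewrite (perm_mem st) (eig w).
have t_le c : c \in t -> c != a -> c <= b by rewrite (perm_mem st); apply: s_le.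
have := a1; rewrite -(permP st).
move: sorted_t a_t b_t t_le; case: {st} t => // x [|y t].
  by rewrite !inE => _ /eqP <- /eqP ab; move: ba; rewrite ab ltxx.
move=> srt a_t b_t t_le cnt.
(* Otherwise [a] lies in the tail and [a <= x <= b]. *)
have xa : x = a.
  apply: contraTeq b_t => xa; move: a_t; rewrite inE eq_sym (negPf xa) /= => a_t.
  have := order_path_min (rev_trans le_trans) srt.
  move=> /allP/(_ _ a_t) /= ax.
  have := lt_le_trans ba (le_trans ax (t_le x _ xa)).
  by rewrite mem_head => /(_ isT); rewrite ltxx.
(* As [a] occurs only once, [y] is another eigenvalue, so [y <= b]; and [b], being different from
   the head, lies in the sorted tail that starts with [y]. *)
split => //=; apply/le_anti/andP; split.
  apply: t_le; first by rewrite !inE eqxx orbT.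
  by apply: contraTneq cnt => ya; rewrite /= xa ya !eqxx.
have : b \in y :: t.
  by move: b_t; rewrite inE xa lt_eqF.
rewrite inE => /orP[/eqP -> //|].
have /andP[_ srt'] := srt.
by have /allP := order_path_min (rev_trans le_trans) srt'; apply.
Qed.

(** * The dot product and a Gram inequality *)

Definition dot (R : pzRingType) (d : nat) (u v : 'cV[R]_d) : R :=
  \sum_k u k 0 * v k 0.

Lemma dotC (R : comPzRingType) (d : nat) (u v : 'cV[R]_d) : dot u v = dot v u.
Proof. by apply: eq_bigr => k _; rewrite mulrC. Qed.

Lemma dotDl (R : pzRingType) (d : nat) (u v w : 'cV[R]_d) :
  dot (u + v) w = dot u w + dot v w.
Proof. by rewrite -big_split; apply: eq_bigr => k _; rewrite mxE mulrDl. Qed.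

Lemma dotZl (R : pzRingType) (d : nat) a (u v : 'cV[R]_d) :
  dot (a *: u) v = a * dot u v.
Proof. by rewrite mulr_sumr; apply: eq_bigr => k _; rewrite mxE mulrA. Qed.

Lemma dotNl (R : pzRingType) (d : nat) (u v : 'cV[R]_d) :
  dot (- u) v = - dot u v.
Proof. by rewrite -scaleN1r dotZl mulN1r. Qed.

Lemma dotDr (R : comPzRingType) (d : nat) (u v w : 'cV[R]_d) :
  dot w (u + v) = dot w u + dot w v.
Proof. by rewrite dotC dotDl !(dotC w). Qed.

Lemma dotZr (R : comPzRingType) (d : nat) a (u v : 'cV[R]_d) :
  dot v (a *: u) = a * dot v u.
Proof. by rewrite dotC dotZl dotC. Qed.

Lemma dotNr (R : comPzRingType) (d : nat) (u v : 'cV[R]_d) :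
  dot v (- u) = - dot v u.
Proof. by rewrite dotC dotNl dotC. Qed.

Definition dotE := (dotDl, dotDr, dotNl, dotNr, dotZl, dotZr).

Lemma dot0l (R : pzRingType) (d : nat) (v : 'cV[R]_d) : dot 0 v = 0.
Proof. by rewrite -(scale0r 0) dotZl mul0r. Qed.

Lemma dot_suml (R : pzRingType) (d n : nat) (u : 'I_n -> 'cV[R]_d)
    (v : 'cV[R]_d) :
  dot (\sum_i u i) v = \sum_i dot (u i) v.
Proof.
rewrite exchange_big; apply: eq_bigr => k _.
by rewrite summxE mulr_suml.
Qed.

Lemma dot_sum (R : comPzRingType) (d n : nat) (u v : 'I_n -> 'cV[R]_d) :
  \sum_i \sum_j dot (u i) (v j) = dot (\sum_i u i) (\sum_j v j).
Proof.
rewrite dot_suml; apply: eq_bigr => i _; rewrite dotC dot_suml.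
by apply: eq_bigr => j _; rewrite dotC.
Qed.

Lemma dot_ge0 (R : realDomainType) (d : nat) (u : 'cV[R]_d) : 0 <= dot u u.
Proof. by apply: sumr_ge0 => k _; rewrite -expr2 sqr_ge0. Qed.

Lemma dot_eq0 (R : realDomainType) (d : nat) (u : 'cV[R]_d) :
  (dot u u == 0) = (u == 0).
Proof.
apply/eqP/eqP => [|->]; last exact: dot0l.
move/psumr_eq0P => u0; apply/colP => k; rewrite mxE; apply/eqP.
rewrite -sqrf_eq0 expr2 u0 // => l _.
by rewrite -expr2 sqr_ge0.
Qed.

Lemma enorm_sqr (R : realType) (d : nat) (u : 'cV[R]_d) :
  enorm u ^+ 2 = dot u u.
Proof.
rewrite sqr_sqrtr; first by apply: eq_bigr => k _; rewrite expr2.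
by apply: sumr_ge0 => k _; rewrite sqr_ge0.
Qed.

Lemma dot_unitB (R : comPzRingType) (d : nat) (p q : 'cV[R]_d) :
  dot p p = 1 -> dot q q = 1 -> dot (p - q) (p - q) = 2 - 2 * dot p q.
Proof. by move=> p1 q1; rewrite !dotE p1 q1 (dotC q p); ring. Qed.

(** This is the nonnegativity of the Gram determinant of [p], [q], [z], expanded for unit [p] and
    [q]. *)
Lemma unit_gram_ge0 (R : realFieldType) (d : nat) (p q z : 'cV[R]_d) :
  dot p p = 1 -> dot q q = 1 ->
  dot p z ^+ 2 + dot q z ^+ 2 - 2 * dot p q * dot p z * dot q z
    <= (1 - dot p q ^+ 2) * dot z z.
Proof.
move=> p1 q1; set c := dot p q.
have cN : 0 <= 2 - 2 * c by rewrite -dot_unitB // dot_ge0.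
have pNq : dot (p - (- q)) (p - (- q)) = 2 - 2 * - c.
  by rewrite dot_unitB ?dotNl ?dotNr ?opprK.
have cP : 0 <= 2 - 2 * - c by rewrite -pNq dot_ge0.
(* For [c = 1] and [c = -1] one has [p = q] and [p = - q], and the bound reads [0 <= 0]. *)
have [c1|c1] := eqVneq c 1.
  have /eqP : dot (p - q) (p - q) = 0 by rewrite dot_unitB // -/c c1; ring.
  by rewrite dot_eq0 subr_eq0 => /eqP ->; rewrite c1; lra.
have [cm1|cm1] := eqVneq c (-1).
  have /eqP : dot (p - - q) (p - - q) = 0 by rewrite pNq cm1; ring.
  by rewrite dot_eq0 subr_eq0 => /eqP ->; rewrite cm1 dotNl; lra.
have c2 : 0 < 1 - c ^+ 2.
  have : 0 < (1 - c) * (1 + c); last by congr (0 < _); ring.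
  by apply: mulr_gt0; rewrite lt_neqAle; apply/andP; split; lra.
(* [u / (1 - c^2)] is the component of [z] orthogonal to [p] and [q]. *)
pose u := (1 - c ^+ 2) *: z - (dot p z - c * dot q z) *: p
  - (dot q z - c * dot p z) *: q.
have := dot_ge0 u.
have -> : dot u u = (1 - c ^+ 2) * ((1 - c ^+ 2) * dot z z -
   (dot p z ^+ 2 + dot q z ^+ 2 - 2 * c * dot p z * dot q z)).
  rewrite !dotE p1 q1 (dotC q p) (dotC z p) (dotC z q) -/c.
  ring.
by rewrite pmulr_rge0 // subr_ge0.
Qed.

(** * Vertex blocks and the quadratic form of the stiffness matrix *)

Definition block (R : pzRingType) (n d : nat) (x : 'cV[R]_(n * d)) (i : 'I_n) :
    'cV[R]_d :=
  \col_k x (mxtens_index (i, k)) 0.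

Definition unblock (R : pzRingType) (n d : nat) (X : 'I_n -> 'cV[R]_d) :
    'cV[R]_(n * d) :=
  \col_r X (mxtens_unindex r).1 (mxtens_unindex r).2 0.

Lemma unblockK (R : pzRingType) (n d : nat) (X : 'I_n -> 'cV[R]_d) (i : 'I_n) :
  block (unblock X) i = X i.
Proof. by apply/colP => k; rewrite !mxE mxtens_indexK. Qed.

Lemma dot_block (R : pzRingType) (n d : nat) (x y : 'cV[R]_(n * d)) :
  dot x y = \sum_i dot (block x i) (block y i).
Proof.
rewrite pair_bigA /= /dot (reindex (@mxtens_index n d)) /=; last first.
  by exists (@mxtens_unindex n d) => k _; rewrite (mxtens_indexK, mxtens_unindexK).
by apply: eq_bigr => -[i k] _; rewrite !mxE.
Qed.

Lemma trmx_mulE (R : pzRingType) (m : nat) (x y : 'cV[R]_m) :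
  (x^T *m y) 0 0 = dot x y.
Proof. by rewrite mxE; apply: eq_bigr => k _; rewrite mxE. Qed.

Lemma dot_edge_vector (R : realType) (n d : nat) (p : 'I_n -> 'cV[R]_d)
    (i j : 'I_n) (x : 'cV[R]_(n * d)) :
  dot (edge_vector p i j) x = dot (direction p i j) (block x i - block x j).
Proof.
have blockE l : block (edge_vector p i j) l =
    ((l == i)%:R - (l == j)%:R) *: direction p i j.
  apply/colP => k; rewrite !mxE mxtens_indexK /=.
  by rewrite !(ord1 (Ordinal _)) eqxx !andbT.
rewrite dot_block; under eq_bigr do rewrite blockE dotZl mulrBl.
have sum1 a (F : 'I_n -> R) : \sum_l (l == a)%:R * F l = F a.
  rewrite (bigD1 a) //= eqxx mul1r big1 ?addr0 // => l /negPf ->.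
  by rewrite mul0r.
by rewrite sumrB !sum1 dotDr dotNr.
Qed.

Lemma directionN (R : realType) (n d : nat) (p : 'I_n -> 'cV[R]_d)
    (i j : 'I_n) : direction p j i = - direction p i j.
Proof.
rewrite /direction eq_sym; case: eqP => _; first by rewrite oppr0.
rewrite -[p j - p i]opprB -scalerN; congr (_^-1 *: _).
by congr Num.sqrt; apply: eq_bigr => k _; rewrite mxE sqrrN.
Qed.

Lemma trmx_stiffness_mx (R : realType) (n d : nat) (p : 'I_n -> 'cV[R]_d) :
  (stiffness_mx p)^T = stiffness_mx p.
Proof. by rewrite trmx_mul trmxK. Qed.

Lemma dot_mulmx (R : comPzRingType) (m n : nat) (M : 'M[R]_(m, n))
    (y : 'cV[R]_m) (z : 'cV[R]_n) :
  dot y (M *m z) = dot (M^T *m y) z.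
Proof. by rewrite -!trmx_mulE trmx_mul trmxK mulmxA. Qed.

(** The stiffness matrix is the sum of the rank-one matrices of its edge vectors. The factor 2 makes
    the sum run over all ordered pairs: the summand is symmetric and vanishes on the diagonal. *)
Lemma stiffness_form (R : realType) (n d : nat) (p : 'I_n -> 'cV[R]_d)
    (x y : 'cV[R]_(n * d)) :
  2 * dot y (stiffness_mx p *m x) =
  \sum_i \sum_j dot (direction p i j) (block y i - block y j) *
                dot (direction p i j) (block x i - block x j).
Proof.
pose G i j := dot (direction p i j) (block y i - block y j) *
  dot (direction p i j) (block x i - block x j).
have Gsym i j : G j i = G i j.
  by rewrite /G directionN !dotE; ring.
have Gdiag i : G i i = 0.
  by rewrite /G /direction eqxx dot0l mul0r.
have -> : dot y (stiffness_mx p *m x) = \sum_(ij in edges n) G ij.1 ij.2.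
  have rigE z e : ((rigidity_mx p)^T *m z) e 0 =
      dot (edge_vector p (enum_val e).1 (enum_val e).2) z.
    by rewrite mxE; apply: eq_bigr => r _; rewrite 2!mxE.
  rewrite -mulmxA dot_mulmx [RHS]big_enum_val.
  by apply: eq_bigr => e _; rewrite !rigE !dot_edge_vector.
rewrite [RHS](pair_bigA _ G) [RHS](bigID (fun ij => ij \in edges n)) /= mulr2n mulrDl mul1r.
congr (_ + _).
(* Among the pairs with [j <= i], the diagonal contributes nothing and the others are swapped
   edges. *)
rewrite [RHS](bigID (fun ij => ij.1 == ij.2)) /= [X in _ = X + _]big1; last first.
  by case=> i j /andP[_ /eqP /= ->].
have swapK : involutive (fun ij : 'I_n * 'I_n => (ij.2, ij.1)) by case.
rewrite add0r [RHS](reindex_inj (inv_inj swapK)) /=.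
apply: eq_big => [[i j]|[i j] _]; last exact: Gsym.
by rewrite !inE -leqNgt ltn_neqAle andbC eq_sym val_eqE.
Qed.

(** * The contribution of a single pair of vertices *)

Lemma dot_direction (R : realType) (n d : nat) (p : 'I_n -> 'cV[R]_d)
    (i j : 'I_n) (x y : 'cV[R]_d) :
  dot (p i - p j) (p i - p j) * (dot (direction p i j) x * dot (direction p i j) y) =
  dot (p i - p j) x * dot (p i - p j) y.
Proof.
rewrite /direction; case: eqP => [->|/eqP ij].
  by rewrite subrr !dot0l !mul0r.
rewrite !dotZl -enorm_sqr; field.
by rewrite -sqrf_eq0 enorm_sqr dot_eq0 subr_eq0.
Qed.

(** Multiplied by [|p_i - p_j|^2 = 2 - 2 c], this becomes the Gram inequality. *)
Lemma edge_form_le (R : realType) (n d : nat) (p : 'I_n -> 'cV[R]_d)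
    (hp : forall i, dot (p i) (p i) = 1) (i j : 'I_n) (z : 'cV[R]_d) :
  dot (direction p i j) z ^+ 2 <=
  2^-1 * (1 + dot (p i) (p j)) * dot z z - dot (p i) z * dot (p j) z.
Proof.
have := unit_gram_ge0 z (hp i) (hp j); set c := dot (p i) (p j) => gram.
(* When the points coincide the direction is 0 and Cauchy-Schwarz for [p j] and [z] remains. *)
have [pij|pij] := eqVneq (p i) (p j).
  rewrite /direction pij eqxx dot0l expr0n /=.
  have := dot_ge0 (z - dot (p j) z *: p j).
  rewrite !dotE (dotC z (p j)) /c pij !hp; lra.
have c1 : 0 < 2 - 2 * c.
  by rewrite -dot_unitB // lt_neqAle dot_ge0 eq_sym dot_eq0 subr_eq0 pij.
rewrite -(ler_pM2l c1) expr2.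
rewrite -{1}dot_unitB // dot_direction !dotE; nra.
Qed.

(** For unit vectors, [<p_i - p_j, a p_i - b p_j> = (a + b) (1 - c)] is [(a + b) / 2] times
    [|p_i - p_j|^2], so the normalization cancels. *)
Lemma edge_form_radial (R : realType) (n d : nat) (p : 'I_n -> 'cV[R]_d)
    (hp : forall i, dot (p i) (p i) = 1) (i j : 'I_n) (a b : R) (z : 'cV[R]_d) :
  dot (direction p i j) z * dot (direction p i j) (a *: p i - b *: p j) =
  2^-1 * (a + b) * dot (p i - p j) z.
Proof.
have [pij|pij] := eqVneq (p i) (p j).
  by rewrite /direction pij eqxx subrr !dot0l mul0r mulr0.
have c0 : dot (p i - p j) (p i - p j) != 0 by rewrite dot_eq0 subr_eq0.
apply: (mulfI c0); rewrite dot_direction dot_unitB // !dotE !hp (dotC (p j) (p i)).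
by field.
Qed.

(** * Sums over all pairs of vertices *)

Lemma sum_dot_mul (R : comPzRingType) (n d : nat)
    (a b c e : 'I_n -> 'cV[R]_d) :
  \sum_i \sum_j dot (a i) (c j) * dot (b i) (e j) =
  \sum_k \sum_l (\sum_i a i k 0 * b i l 0) * (\sum_j c j k 0 * e j l 0).
Proof.
under eq_bigr do under eq_bigr do rewrite big_distrlr pair_bigA.
under [RHS]eq_bigr do under eq_bigr do rewrite big_distrlr pair_bigA.
rewrite [LHS]pair_bigA [RHS]pair_bigA [LHS]exchange_big /=.
by apply: eq_bigr => kl _; apply: eq_bigr => ij _; ring.
Qed.

Lemma half_double (R : numFieldType) (a : R) : 2^-1 * (a + a) = a.
Proof. by field. Qed.

(** The double sum is the squared norm of [\sum_i p_i /\ x_i]. *)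
Lemma sum_wedge_ge0 (R : realFieldType) (n d : nat) (p x : 'I_n -> 'cV[R]_d) :
  0 <= \sum_i \sum_j (dot (p i) (p j) * dot (x i) (x j)
                      - dot (p i) (x j) * dot (x i) (p j)).
Proof.
under eq_bigr do rewrite sumrB.
rewrite sumrB !sum_dot_mul; set M := fun k l => \sum_i p i k 0 * x i l 0.
(* Twice the sum is the squared norm of the antisymmetric part [M - M^T]. *)
pose S := \sum_k \sum_l (M k l - M l k) ^+ 2.
suff -> : \sum_k \sum_l M k l * M k l -
   \sum_k \sum_l M k l * (\sum_j x j k 0 * p j l 0) = 2^-1 * S.
  by rewrite mulr_ge0 ?invr_ge0 //; do 2![apply: sumr_ge0 => ? _]; rewrite sqr_ge0.
under [X in _ - X]eq_bigr => k _ do under eq_bigr => l _ do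
  (under [X in _ * X]eq_bigr => j _ do rewrite mulrC).
have -> : S = \sum_k \sum_l (M k l * M k l - M k l * M l k)
     + \sum_k \sum_l (M l k * M l k - M l k * M k l).
  rewrite -big_split; apply: eq_bigr => k _; rewrite -big_split.
  by apply: eq_bigr => l _ /=; ring.
rewrite [X in 2^-1 * (_ + X)]exchange_big /= half_double.
by rewrite -sumrB; apply: eq_bigr => k _; rewrite -sumrB.
Qed.

(** It allows a symmetric summand to be traded for a shorter asymmetric one with the same total. *)
Lemma sum_symmetrize (R : numFieldType) (n : nat) (H : 'I_n -> 'I_n -> R) :
  \sum_i \sum_j 2^-1 * (H i j + H j i) = \sum_i \sum_j H i j.
Proof.
under eq_bigr do rewrite -mulr_sumr big_split.
rewrite -mulr_sumr big_split /= [X in _ + X]exchange_big /=.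
by rewrite half_double.
Qed.

Lemma sum_const_ord (R : pzRingType) (n : nat) (a : R) : \sum_(i < n) a = n%:R * a.
Proof. by rewrite sumr_const card_ord mulr_natl. Qed.

Lemma stiffness_radial (R : realType) (n d : nat) (p : 'I_n -> 'cV[R]_d)
    (hp : forall i, dot (p i) (p i) = 1) (hp_sum : \sum_i p i = 0)
    (f : 'I_n -> R) (m : 'cV[R]_d) (y : 'cV[R]_(n * d)) :
  2 * dot y (stiffness_mx p *m unblock (fun i => f i *: p i + m)) =
  n%:R * (\sum_i f i * dot (p i) (block y i))
  + (\sum_i f i) * (\sum_i dot (p i) (block y i))
  - dot (\sum_i f i *: p i) (\sum_i block y i).
Proof.
rewrite stiffness_form.
(* Symmetrizing [H] gives [(f_i + f_j) / 2 * <p_i - p_j, y_i - y_j>]; the shift [m] cancels in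
   differences. The last term of [H] sums to 0 because the [p i] do. *)
pose H i j := f i * dot (p i) (block y i) + dot (p i) (block y i) * f j
  - dot (f i *: p i) (block y j) - dot (p i) (f j *: block y j).
transitivity (\sum_i \sum_j 2^-1 * (H i j + H j i)).
  apply: eq_bigr => i _; apply: eq_bigr => j _.
  rewrite !unblockK opprD addrACA subrr addr0 edge_form_radial // /H !dotE.
  by ring.
rewrite sum_symmetrize /H.
under eq_bigr do rewrite !sumrB big_split sum_const_ord -mulr_sumr /=.
rewrite !sumrB big_split !dot_sum hp_sum dot0l subr0 -mulr_suml -mulr_sumr /=.
by rewrite [X in _ + X - _]mulrC.
Qed.

Lemma stiffness_form_le (R : realType) (n d : nat) (p : 'I_n -> 'cV[R]_d)
    (hp : forall i, dot (p i) (p i) = 1) (hp_sum : \sum_i p i = 0)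
    (x : 'cV[R]_(n * d)) :
  \sum_i dot (p i) (block x i) = 0 ->
  2 * dot x (stiffness_mx p *m x) <= n%:R * dot x x.
Proof.
move=> xp; rewrite stiffness_form dot_block.
set X := block x in xp *; pose f i := dot (p i) (X i).
pose W i j := dot (p i) (p j) * dot (X i) (X j) - dot (p i) (X j) * dot (X i) (p j).
(* Symmetrizing [H] gives exactly the bound of [edge_form_le] at [z = x_i - x_j]. On summation, the
   term paired with [p j] vanishes by [hp_sum], [f i * f j] by [xp], and the two subtracted terms
   have nonnegative sums. *)
pose H i j := dot (X i) (X i)
  + dot (dot (X i) (X i) *: p i - (2 * f i) *: X i) (p j)
  + f i * f j - dot (X i) (X j) - W i j.
apply: (@le_trans _ _ (\sum_i \sum_j 2^-1 * (H i j + H j i))).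
  apply: ler_sum => i _; apply: ler_sum => j _.
  rewrite -expr2; apply: le_trans (edge_form_le hp i j (X i - X j)) _.
  rewrite le_eqVlt; apply/orP; left; apply/eqP.
  rewrite /H /W /f !dotE (dotC (X j) (X i)) (dotC (p j) (p i)).
  by rewrite !(dotC (X _) (p _)); field.
have W0 : 0 <= \sum_i \sum_j W i j by apply: sum_wedge_ge0.
have f0 : \sum_i f i = 0 by [].
rewrite sum_symmetrize /H; clearbody W f.
under eq_bigr do rewrite !sumrB !big_split sum_const_ord -mulr_sumr f0 mulr0 /=.
rewrite !sumrB !big_split /= !dot_sum hp_sum (dotC _ 0) dot0l big1_eq -mulr_sumr.
by have := dot_ge0 (\sum_i X i); lra.
Qed.

(** * The two eigenvectors and the conclusion *)

Lemma dot_nondegenerate (R : realDomainType) (m : nat) (u w : 'cV[R]_m) :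
  (forall y, dot y u = dot y w) -> u = w.
Proof.
move=> uw; apply/eqP; rewrite -subr_eq0 -dot_eq0 dotDr dotNr uw subrr.
by [].
Qed.

Theorem theorem1 (R : realType) (n d : nat) (hd : (2 <= d)%N)
    (p : 'I_n -> 'cV[R]_d)
    (hp_unit : forall i, enorm (p i) = 1)
    (hp_sum : \sum_i p i = 0)
    (hp_three : exists i j k : 'I_n, [/\ p i <> p j, p i <> p k & p j <> p k]) :
  is_kth_largest_eigenvalue (stiffness_mx p) 2 (n%:R / 2).
Proof.
have hp i : dot (p i) (p i) = 1 by rewrite -enorm_sqr hp_unit expr1n.
have p0 i : p i != 0 by rewrite -dot_eq0 hp oner_eq0.
case: hp_three => i [j [k [ij ik jk]]].
have n0 : 0 < n%:R :> R by rewrite ltr0n (leq_ltn_trans _ (ltn_ord i)).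
(* This [f] has sum 0 and vanishes at [k], which makes [w] below nonzero. *)
pose f l : R := (l == i)%:R - (l == j)%:R.
have sum1 a : \sum_(l < n) (l == a)%:R = 1 :> R.
  by rewrite (bigD1 a) //= eqxx big1 ?addr0 // => l /negPf ->.
have f_sum : \sum_l f l = 0 by rewrite sumrB !sum1 subrr.
(* With this shift, pairing [w] with [y] and multiplying by [n] reproduces the last term of
   [stiffness_radial]. *)
pose m := - (n%:R^-1 *: \sum_l f l *: p l).
pose v := unblock p; pose w := unblock (fun l => f l *: p l + m).
have vE : v = unblock (fun l => 1 *: p l + 0).
  by apply/colP => r; rewrite !mxE mul1r addr0.
apply: (@second_largest_eigenvalue _ _ _ v w n%:R).
- exact: trmx_stiffness_mx.
- lra.
- apply/eqP => /(congr1 (fun x => block x i)); rewrite unblockK => pi0.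
  case/eqP: (p0 i); rewrite pi0; apply/colP => l; by rewrite !mxE.
- apply: dot_nondegenerate => y; apply: (mulfI (_ : 2 != 0)); first by rewrite pnatr_eq0.
  rewrite {1}vE stiffness_radial // sum_const_ord dotZr dot_block.
  rewrite -scaler_sumr hp_sum scaler0 dot0l.
  under eq_bigr do rewrite mul1r.
  under [in RHS]eq_bigr do rewrite unblockK dotC.
  by ring.
(* Block [k] of [w] is [m], so [m = 0]; then block [i] gives [p i = 0], which contradicts [p0]. *)
- apply/eqP => w0.
  have wl l : f l *: p l + m = 0.
    by rewrite -(unblockK (fun l => f l *: p l + m)) -/w w0; apply/colP => r; rewrite !mxE.
  have ki : k == i = false by apply/eqP => e; apply: ik; rewrite e.
  have kj : k == j = false by apply/eqP => e; apply: jk; rewrite e.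
  have ij' : i == j = false by apply/eqP => e; apply: ij; rewrite e.
  have := wl i; have := wl k; rewrite /f ki kj ij' eqxx !subr0 scale0r add0r => ->.
  by rewrite addr0 scale1r => /eqP; rewrite (negPf (p0 i)).
- apply: dot_nondegenerate => y; apply: (mulfI (_ : 2 != 0)); first by rewrite pnatr_eq0.
  rewrite stiffness_radial // f_sum mul0r addr0 dotZr dot_block.
  under [in RHS]eq_bigr do rewrite unblockK dotDr dotZr (dotC _ (p _)).
  rewrite big_split /= -dot_suml /m dotNr dotZr (dotC (\sum_l block y l)).
  by field; rewrite gt_eqF.
- move=> x vx; rewrite -mulmxA !trmx_mulE.
  have px : \sum_l dot (p l) (block x l) = 0.
    under eq_bigr do rewrite -(unblockK p).
    by rewrite -dot_block -trmx_mulE vx mxE.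
  have := stiffness_form_le hp hp_sum px; lra.
Qed.
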